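(* Let $t\geq 1$, $k\geq 2$ and $n\geq (k-2)t+4$ be integers, and let $G$ be a $t$-connected graph of order $n$ with $\rho(\overline{G})\leq \sqrt{(n-1-t)(kt-t+1)}$. (i) If $t\in\{1,2\}$, then $G$ has a spanning $k$-tree unless $G\in\mathbb{G}_1(k,t)$. (ii) If $3\leq t\leq n-1$ and $G\notin\mathbb{G}_2(k,t)$, then $G$ has a spanning $k$-tree unless $G\in\mathbb{G}_1(k,t)$.
   Context: All graphs are finite, simple and undirected. $\overline{G}$ is the complement of $G$, and $\rho(\cdot)$ is the largest eigenvalue of the adjacency matrix. A graph is $t$-connected if it has more than $t$ vertices and remains connected whenever fewer than $t$ vertices are removed. A spanning $k$-tree of $G$ is a spanning tree of $G$ with maximum degree at most $k$. $mK_1$ denotes $m$ isolated vertices, $\vee$ denotes join, and $R(m,s)$ denotes an (arbitrary) $s$-regular graph of order $m$. $\mathcal{G}_m$ denotes the set of all graphs of order $m\geq 0$ (for $m=0$ this is the null graph, and joining with it leaves a graph unchanged). Define $\mathbb{G}_1(k,t)=\{G_t\vee (kt-t+2)K_1 : G_t\in\mathcal{G}_t\}$ and $\mathbb{G}_2(k,t)=\{G_r\vee R(kt+2-r,t-r) : 0\leq r\leq t-3,\ G_r\in\mathcal{G}_r,\ R(kt+2-r,t-r)\text{ any }(t-r)\text{-regular graph of order }kt+2-r\}$. *)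

(* Defs.v *)
From HB Require Import structures.
From mathcomp Require Import all_boot all_order all_algebra.
From mathcomp Require Import classical_sets reals.

Set Implicit Arguments.
Unset Strict Implicit.
Unset Printing Implicit Defensive.

Import Order.TTheory GRing.Theory Num.Theory.

Record sgraph (V : finType) := SGraph {
  adj :> rel V;
  adj_sym : symmetric adj;
  adj_irr : irreflexive adj
}.

Section Constructions.
Variables (V W : finType).

Definition compl_rel (G : sgraph V) : rel V :=
  [rel x y | (x != y) && ~~ adj G x y].

Fact compl_sym (G : sgraph V) : symmetric (compl_rel G).
Proof. by move=> x y; rewrite /compl_rel /= eq_sym adj_sym. Qed.

Fact compl_irr (G : sgraph V) : irreflexive (compl_rel G).
Proof. by move=> x; rewrite /compl_rel /= eqxx. Qed.

Definition compl (G : sgraph V) : sgraph V :=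
  SGraph (compl_sym G) (compl_irr G).

Definition join_rel (G : sgraph V) (H : sgraph W) : rel (V + W) :=
  fun x y => match x, y with
    | inl a, inl b => adj G a b
    | inr a, inr b => adj H a b
    | _, _ => true
  end.

Fact join_sym (G : sgraph V) (H : sgraph W) : symmetric (join_rel G H).
Proof. by move=> [x|x] [y|y] //=; rewrite adj_sym. Qed.

Fact join_irr (G : sgraph V) (H : sgraph W) : irreflexive (join_rel G H).
Proof. by move=> [x|x] /=; rewrite adj_irr. Qed.

Definition join (G : sgraph V) (H : sgraph W) : sgraph (V + W)%type :=
  SGraph (join_sym G H) (join_irr G H).

Definition induced_rel (G : sgraph V) (A : {set V}) : rel {x : V | x \in A} :=
  fun x y => adj G (val x) (val y).

Fact induced_sym (G : sgraph V) (A : {set V}) : symmetric (@induced_rel G A).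
Proof. by move=> x y; rewrite /induced_rel adj_sym. Qed.

Fact induced_irr (G : sgraph V) (A : {set V}) : irreflexive (@induced_rel G A).
Proof. by move=> x; rewrite /induced_rel adj_irr. Qed.

Definition induced (G : sgraph V) (A : {set V}) : sgraph {x : V | x \in A} :=
  SGraph (@induced_sym G A) (@induced_irr G A).

Definition isomorphic (G : sgraph V) (H : sgraph W) : Prop :=
  exists2 f : V -> W, bijective f & forall x y, adj H (f x) (f y) = adj G x y.

End Constructions.

Fact edgeless_sym (V : finType) : symmetric (fun _ _ : V => false).
Proof. by []. Qed.

Fact edgeless_irr (V : finType) : irreflexive (fun _ _ : V => false).
Proof. by []. Qed.

Definition edgeless (m : nat) : sgraph 'I_m :=
  SGraph (@edgeless_sym 'I_m) (@edgeless_irr 'I_m).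

Section Properties.
Variable V : finType.

Definition deg (G : sgraph V) (x : V) : nat := #|[set y | adj G x y]|.

Definition regular (s : nat) (G : sgraph V) : Prop := forall x, deg G x = s.

Definition connected (G : sgraph V) : Prop := forall x y, connect (adj G) x y.

(* No cycle of length at least 3; [ucycle] also accepts the closed walk
   x, y, x along a single edge, hence the bound on the size. *)
Definition acyclic (G : sgraph V) : Prop :=
  forall c : seq V, ucycle (adj G) c -> size c < 3.

Definition is_tree (G : sgraph V) : Prop := connected G /\ acyclic G.

Definition spanning_ktree (k : nat) (G T : sgraph V) : Prop :=
  [/\ subrel (adj T) (adj G), is_tree T & forall x, deg T x <= k].

Definition has_spanning_ktree (k : nat) (G : sgraph V) : Prop :=
  exists T : sgraph V, spanning_ktree k G T.

End Properties.

Definition t_connected (V : finType) (t : nat) (G : sgraph V) : Prop :=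
  t < #|V| /\
  forall S : {set V}, #|S| < t -> connected (induced G (~: S)).

Definition adj_mx (R : realType) (V : finType) (G : sgraph V) : 'M[R]_#|V| :=
  (\matrix_(i, j) (adj G (enum_val i) (enum_val j))%:R)%R.

(* The set of real eigenvalues is finite, and nonempty as soon as V is
   (the matrix is symmetric), so that this supremum is a maximum. *)
Definition rho (R : realType) (V : finType) (G : sgraph V) : R :=
  sup [set a : R | eigenvalue (adj_mx R G) a]%classic.

(* Membership in a family of graphs is up to isomorphism.  No subtraction
   below is truncated when k >= 1 (r being at most t - 3). *)
Definition family1 (k t : nat) (V : finType) (G : sgraph V) : Prop :=
  exists Gt : sgraph 'I_t, isomorphic G (join Gt (edgeless (k * t - t + 2))).

Definition family2 (k t : nat) (V : finType) (G : sgraph V) : Prop :=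
  exists (r : nat) (Gr : sgraph 'I_r) (H : sgraph 'I_(k * t + 2 - r)),
    [/\ r + 3 <= t, regular (t - r) H & isomorphic G (join Gr H)].

(* Main.v *)
Require Import Defs.
From mathcomp Require Import all_boot all_order all_algebra.
From mathcomp Require Import boolp reals zify.
From mathcomp Require classical_sets complex.

Set Implicit Arguments.
Unset Strict Implicit.
Unset Printing Implicit Defensive.

Import Order.TTheory GRing.Theory Num.Theory.

(* Suppose that G has no spanning k-tree and let H be an edge-maximal
   supergraph of G without one.  If u and v are not adjacent in H, then H + uv
   has a spanning k-tree; deleting uv leaves two trees rooted at u and v, and
   exchanging edges shows that d(u) + d(v) <= n - 2 - (k - 2)t in H.  Hence,
   with a = n - 1 - t, b = kt - t + 1 and D the degrees in the complement of H,
   D(u) + D(v) >= a + b and D(u), D(v) <= a for every edge uv of the complement,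
   so that D(u)D(v) >= ab.  Rayleigh's inequality at the vector (sqrt D(x))_x
   gives rho >= sqrt(ab) with equality only if D(u)D(v) = ab, i.e.
   {D(u), D(v)} = {a, b}, on every edge.  If a <> b the complement of H is
   complete bipartite and H is disconnected.  If a = b then n = kt + 2 and H is
   the join of r <= t universal vertices with a (t - r)-regular graph; G agrees
   with H outside the universal vertices.  The cases r = t and r <= t - 3 are
   the two exceptional families, and r = t - 1, t - 2 are excluded by the tight
   case of the exchange argument. *)

(** * Rayleigh's inequality *)

Section Rayleigh.
Local Open Scope ring_scope.
Import classical_sets complex.
Variable R : realType.

(** Over [R[i]] the matrix is hermitian, hence diagonalized by a unitary matrix [P] with real
    eigenvalues; [c x i] is the squared modulus of the [i]-th coordinate of [x] in that eigenbasis.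
    Stating only [d] and [c] keeps the complex numbers out of what follows. *)
Lemma symmetric_spectral_form n (A : 'M[R]_n) : A^T = A ->
  exists (d : 'I_n -> R) (c : 'rV[R]_n -> 'I_n -> R),
  [/\ forall i, eigenvalue A (d i), forall x i, 0 <= c x i,
      forall x, (x *m A *m x^T) 0 0 = \sum_i d i * c x i
    & forall x, (x *m x^T) 0 0 = \sum_i c x i].
Proof.
move=> symA; pose f : {rmorphism R -> R[i]} := real_complex R.
pose B := map_mx f A.
have realB m p (M : 'M[R]_(m, p)) : map_mx f M \is a mxOver Num.real.
  by apply/mxOverP => i j; rewrite mxE complex_real.
have hermB : B \is hermsymmx.
  apply: realsym_hermsym (realB _ _ A).
  apply/is_hermitianmxP; rewrite expr0 scale1r map_mx_id //.
  by rewrite map_trmx symA.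
have /orthomx_spectralP := hermitian_normalmx hermB.
have /mxOverP /(_ 0) realD := hermitian_spectral_diag_real hermB.
have := spectral_unitarymx B.
move: (spectralmx B) (spectral_diag B) realD => P D realD unP defB.
have unitP := unitarymx_unit unP; have invP := invmx_unitary unP.
pose y (x : 'rV[R]_n) := map_mx f x *m invmx P.
exists (fun i => Re (D 0 i)), (fun x i => Re (y x 0 i * (y x 0 i)^*%C)).
have defD i : f (Re (D 0 i)) = D 0 i.
  exact: RRe_real (realD i).
have defc x i : f (Re (y x 0 i * (y x 0 i)^*%C)) = y x 0 i * (y x 0 i)^*%C.
  by apply: RRe_real; rewrite ger0_real // mulcJ_ge0.
have yC x : P *m (map_mx f x)^T = (map_mx conjc (y x))^T.
  rewrite /y invP map_mxM trmx_mul; congr (_ *m _^T); apply/matrixP => i j.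
    by rewrite !mxE; exact: (esym (conjcK _)).
  by rewrite !mxE /= oppr0.
split.
- move=> i; rewrite -(eigenvalue_map f) [X in eigenvalue _ X]defD.
  apply/eigenvalueP.
  exists (row i P).
    rewrite -/B defB !mulmxA -row_mul mulmxV // -row_mul mul1mx.
    by apply/rowP => j; rewrite -row_mul mxE mul_diag_mx !mxE.
  apply/eqP => /(congr1 (mulmx^~ (invmx P))) /rowP/(_ i)/eqP.
  by rewrite -row_mul mulmxV // mul0mx !mxE eqxx oner_eq0.
- by move=> x i; rewrite -ler0c -[X in _ <= X]/(f _) defc mulcJ_ge0.
- move=> x; apply: (@complexI R); rewrite -[LHS]/(f _) -[RHS]/(f _).
  transitivity ((map_mx f x *m B *m (map_mx f x)^T) 0 0).
    by rewrite map_trmx -!map_mxM [RHS]mxE.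
  rewrite defB !mulmxA -/(y x) -mulmxA yC mxE rmorph_sum.
  apply: eq_bigr => i _; rewrite rmorphM /= defD defc.
  by rewrite mul_mx_diag !mxE; rewrite mulrAC mulrC mulrA.
- move=> x; apply: (@complexI R); rewrite -[LHS]/(f _) -[RHS]/(f _).
  transitivity ((map_mx f x *m (map_mx f x)^T) 0 0).
    by rewrite map_trmx -!map_mxM [RHS]mxE.
  rewrite -{1}[map_mx f x](mulmxKV unitP) -/(y x) -mulmxA yC mxE rmorph_sum.
  by apply: eq_bigr => i _; rewrite /= defc !mxE.
Qed.

Lemma rayleigh_le_sup_eigenvalue n (A : 'M[R]_n) (x : 'rV[R]_n) : A^T = A ->
  (x *m A *m x^T) 0 0 <=
  sup [set a : R | eigenvalue A a]%classic * (x *m x^T) 0 0.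
Proof.
move=> /symmetric_spectral_form[d [c [eig_d c_ge0 defA def1]]].
rewrite defA def1 mulr_sumr; apply: ler_sum => i _.
apply: ler_wpM2r => //; apply: ub_le_sup (eig_d i).
(* The supremum bounds its set only if that set is bounded above. The spectral form at an
   eigenvector [v] of [a] shows that the sum of the [|d j|] is an upper bound. *)
exists (\sum_j `|d j|) => a /= /eigenvalueP[v vA v_neq0].
have d_le j : d j <= \sum_j `|d j|.
  rewrite (bigD1 j) //= ler_wpDr ?ler_norm //.
  by apply: sumr_ge0 => *; rewrite normr_ge0.
have v_gt0 : 0 < (v *m v^T) 0 0.
  rewrite mxE lt_neqAle eq_sym psumr_neq0 => [|j _]; last first.
    by rewrite mxE -expr2 sqr_ge0.
  rewrite sumr_ge0 => [|j _]; last by rewrite mxE -expr2 sqr_ge0.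
  rewrite andbT; apply/hasP.
  have /existsP[j vj] : [exists j, v 0 j != 0].
    apply: contraNT v_neq0; rewrite negb_exists => /forallP v0.
    by apply/eqP/rowP => j; rewrite mxE; apply/eqP; rewrite -[_ == _]negbK.
  exists j; first by rewrite mem_index_enum.
  by rewrite mxE -expr2 /= lt_neqAle sqr_ge0 eq_sym sqrf_eq0 vj.
rewrite -(ler_pM2r v_gt0).
have -> : a * (v *m v^T) 0 0 = (v *m A *m v^T) 0 0.
  by rewrite vA -scalemxAl [RHS]mxE.
rewrite defA def1 mulr_sumr; apply: ler_sum => j _.
exact: ler_wpM2r.
Qed.

Lemma rayleigh_le_rho (V : finType) (G : sgraph V) (x : V -> R) :
  \sum_u \sum_v (adj G u v)%:R * (x u * x v) <= rho R G * \sum_u x u ^+ 2.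
Proof.
have sum_ord (F : V -> R) : \sum_u F u = \sum_(i < #|V|) F (enum_val i).
  by rewrite (reindex (@enum_val V V)) //; apply: onW_bij; exact: enum_val_bij.
have symA : (adj_mx R G)^T = adj_mx R G.
  by apply/matrixP => i j; rewrite !mxE adj_sym.
have := rayleigh_le_sup_eigenvalue (\row_i x (enum_val i)) symA.
rewrite -/(rho R G) !mxE; congr (_ <= rho R G * _); last first.
  by rewrite sum_ord; apply: eq_bigr => i _; rewrite !mxE.
under [RHS]eq_bigr do rewrite sum_ord.
rewrite sum_ord exchange_big; apply: eq_bigr => j _ /=.
rewrite !mxE mulr_suml; apply: eq_bigr => i _; rewrite !mxE /=.
by rewrite mulrCA mulrA.
Qed.

End Rayleigh.

(** * Spanning trees and edge exchanges *)

Section SpanningTrees.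
Variable V : finType.

(** Breadth-first search from [S]: [h x] is the distance of [x] from [S], and [p x] a predecessor in
    an earlier layer. *)
Lemma spanning_forest (e : rel V) (S : {set V}) :
  (forall x, exists2 y, y \in S & connect e y x) ->
  exists (p : V -> V) (h : V -> nat),
    forall x, x \notin S -> e (p x) x /\ h (p x) < h x.
Proof.
move=> reachS.
pose ball n := iter n (fun A => A :|: [set x | [exists y in A, e y x]]) S.
have in_ball x : exists n, x \in ball n.
  have [y Sy /connectP[q]] := reachS x; have: y \in ball 0 by [].
  elim: q y {Sy} 0 => [|z q IHq] y n ny /=; first by move=> _ ->; exists n.
  case/andP=> yz qz; apply: (IHq z n.+1) => //.
  by rewrite !inE; apply/orP; right; apply/existsP; exists y; rewrite ny.
pose h x := ex_minn (in_ball x).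
have hP x n : x \in ball n -> h x <= n.
  by rewrite /h; case: ex_minnP => m _ min_m /min_m.
have parent x : exists y, x \notin S -> e y x /\ h y < h x.
  have [Sx|S'x] := boolP (x \in S); first by exists x.
  suff [y] : exists y, e y x /\ h y < h x by exists y.
  move: (erefl (h x)); rewrite {1}/h; case: ex_minnP => -[|m].
    by rewrite /= (negPf S'x).
  rewrite !inE => /orP[xm /(_ _ xm)|/existsP[y /andP[ym yx]] _ hx].
    by rewrite ltnn.
  by exists y; rewrite -hx ltnS; split=> //; apply: hP.
by have [p pP] := choice parent; exists p, h.
Qed.

(** A breadth-first tree of [e] only loses edges, so the degree bound survives. Thanks to this, the
    exchanges below never have to check acyclicity. *)
Lemma spanning_ktree_of_connected k (G : sgraph V) (e : rel V) (x0 : V) :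
  symmetric e -> subrel e (adj G) -> (forall x y, connect e x y) ->
  (forall x, #|[set y | e x y]| <= k) -> has_spanning_ktree k G.
Proof.
move=> sym_e sub_e conn_e deg_e.
have [|p [h pP]] := @spanning_forest e [set x0].
  by move=> x; exists x0; rewrite ?set11.
have {}pP x : x != x0 -> e (p x) x /\ h (p x) < h x.
  by move=> xx0; apply: pP; rewrite inE.
pose T x y := (x != x0) && (p x == y) || (y != x0) && (p y == x).
have symT : symmetric T by move=> x y; rewrite /T orbC.
have irrT : irreflexive T.
  move=> x; rewrite /T orbb; apply/negP=> /andP[/pP[_ +] /eqP px].
  by rewrite px ltnn.
have subT : subrel T e.
  move=> x y /orP[] /andP[/pP[ep _] /eqP<-] //.
  by rewrite sym_e.
exists (SGraph symT irrT); split=> [x y /subT /sub_e||x] //; last first.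
  apply: leq_trans (deg_e x); apply/subset_leq_card/subsetP => y.
  by rewrite !inE => /subT.
split=> [|c /andP[cyc_c uniq_c]] /=.
  suff root_conn x : connect T x0 x.
    move=> x y; apply: connect_trans (root_conn y).
    by rewrite (sym_connect_sym symT) root_conn.
  have [n] := ubnP (h x); elim: n x => // n IHn x; rewrite ltnS => hx.
  have [->|xx0] := eqVneq x x0; first exact: connect0.
  have [_ hp] := pP x xx0; apply: connect_trans (IHn (p x) _) _.
    exact: leq_trans hp hx.
  by apply: connect1; rewrite /T xx0 eqxx orbT.
(* Both neighbours on the cycle of a vertex of maximal rank are its parent. *)
rewrite ltnNge; apply/negP => size_c.
have [x1 x1c] : exists x, x \in c.
  by case: c size_c {cyc_c uniq_c} => // x s _; exists x; rewrite mem_head.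
have [x xc max_x] := @arg_maxnP V x1 (mem c) h x1c.
have up y : y \in c -> T x y -> y = p x.
  move=> yc /orP[/andP[_ /eqP->] //|/andP[/pP[_ +] /eqP py]].
  by rewrite py ltnNge => /negP[]; apply: max_x.
have [i s def_s] := rot_to xc.
have mem_s y : (y \in c) = (y \in x :: s) by rewrite -def_s mem_rot.
rewrite -(rot_uniq i) def_s in uniq_c; rewrite -(rot_cycle i) def_s in cyc_c.
rewrite -(size_rot i) def_s in size_c.
case: s => [|y s] in def_s mem_s uniq_c cyc_c size_c => //.
case: (lastP s) => [|s' z] in def_s mem_s uniq_c cyc_c size_c => //.
have defy : y = p x.
  apply: up; first by rewrite mem_s !inE eqxx orbT.
  by case/andP: cyc_c.
have defz : z = p x.
  apply: up; first by rewrite mem_s !inE mem_rcons !inE eqxx !orbT.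
  move: cyc_c; rewrite /= rcons_path last_rcons => /and3P[_ _].
  by rewrite symT.
by move: uniq_c; rewrite /= mem_rcons inE defy defz eqxx !andbF.
Qed.

(** The guard [u != v] keeps the relation irreflexive, so that [add_edge] is defined for all [u] and
    [v]. *)
Definition insert_edge (G : sgraph V) (u v : V) : rel V :=
  [rel x y | adj G x y ||
    (u != v) && ((x == u) && (y == v) || (x == v) && (y == u))].

Fact insert_edge_sym (G : sgraph V) u v : symmetric (insert_edge G u v).
Proof.
move=> x y; rewrite /insert_edge /= adj_sym; congr (_ || (_ && _)).
by rewrite orbC (andbC (x == v)) (andbC (x == u)).
Qed.

Fact insert_edge_irr (G : sgraph V) u v : irreflexive (insert_edge G u v).
Proof.
move=> x; rewrite /insert_edge /= adj_irr /=.
have [->|] := eqVneq x u; last by rewrite !andbF.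
by case: (u == v).
Qed.

Definition add_edge (G : sgraph V) (u v : V) : sgraph V :=
  SGraph (insert_edge_sym G u v) (insert_edge_irr G u v).

End SpanningTrees.

(** * Exchanges between the two trees left by deleting an edge *)

Section Exchange.
Variables (V : finType) (k : nat) (G : sgraph V) (u v : V).

(** The k-tree of G + uv must use the edge uv. Deleting it leaves two trees rooted at [u] and [v]:
    [s] tells them apart (true on the side of [u]), [p] is the parent map and [h] the depth. *)
Lemma rooted_forest : u != v ->
    ~ has_spanning_ktree k G -> has_spanning_ktree k (add_edge G u v) ->
  exists (s : V -> bool) (p : V -> V) (h : V -> nat),
  [/\ s u, ~~ s v,
      forall x, x \notin [set u; v] ->
        [/\ adj G x (p x), h (p x) < h x & s (p x) = s x]
    & forall x, #|[set y in ~: [set u; v] | p y == x]| < k].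
Proof.
move=> uv noG [T [subT [connT _] degT]].
pose uvE := [rel x y : V | (x == u) && (y == v) || (x == v) && (y == u)].
pose e := [rel x y | adj T x y && ~~ uvE x y].
have sym_uvE : symmetric uvE.
  by move=> x y; rewrite /= orbC (andbC (x == v)) (andbC (x == u)).
have sym_e : symmetric e 
  by move=> x y; rewrite /e /= adj_sym; congr (_ && ~~ _); apply: sym_uvE.
have csym_e := sym_connect_sym sym_e.
have sub_eT : subrel e (adj T) by move=> x y /andP[].
have sub_eG : subrel e (adj G).
  by move=> x y /andP[/subT /orP[//|/andP[_ xy]]]; rewrite /= xy.
have deg_e x : #|[set y | e x y]| <= k.
  apply: leq_trans (degT x); apply/subset_leq_card/subsetP => y.
  by rewrite !inE => /andP[].
have reach x : connect e u x || connect e v x.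
  pose A := [pred x | connect e u x || connect e v x].
  suff /closed_connect/(_ _ _ (connT u x)) : closed (adj T) A.
    by rewrite !inE connect0.
  apply: (intro_closed (sym_connect_sym (@adj_sym _ T))) => y z Tyz.
  have [|] := boolP (uvE y z).
    by case/orP=> /andP[/eqP-> /eqP->]; rewrite !inE !connect0 ?orbT.
  move=> nyz; have eyz : e y z by rewrite /= Tyz.
  by rewrite !inE -!(same_connect_r csym_e (@connect1 _ e _ _ eyz)).
(* Otherwise [e] would be connected and would give a spanning k-tree of [G]. *)
have uv_e : ~~ connect e u v.
  apply/negP => conn_uv; apply: noG.
  have conn_u x : connect e u x.
    by case/orP: (reach x) => // /(connect_trans conn_uv).
  apply: (spanning_ktree_of_connected u sym_e sub_eG _ deg_e) => x y.
  by apply: connect_trans (conn_u y); rewrite csym_e.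
have Tuv : adj T u v.
  case: (boolP (adj T u v)) => // nTuv; case/negP: uv_e.
  have eT : e =2 adj T.
    move=> x y /=; case: (boolP (adj T x y)) => //= Txy.
    apply/negP => /orP[] /andP[/eqP xu /eqP yv]; move: Txy; rewrite xu yv.
      by rewrite (negPf nTuv).
    by rewrite adj_sym (negPf nTuv).
  by rewrite (eq_connect eT).
have [|p [h pP]] := @spanning_forest _ e [set u; v].
  move=> x; case/orP: (reach x) => ?; [exists u | exists v] => //.
    exact: set21.
  exact: set22.
exists (connect e u), p, h; split=> // [x /pP[ex hx]|x].
- split=> //; first by apply: sub_eG; rewrite sym_e.
  by rewrite (same_connect_r csym_e (@connect1 _ e _ _ ex)).
have {}pP z : ~~ ((z == u) || (z == v)) -> e (p z) z /\ h (p z) < h z.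
  by move=> zR; apply: pP; rewrite !inE.
(* Fewer than [k] children: [y] is a neighbour of [x] in [T] that is not a child, namely its parent
   or, for a root, the other end of the deleted edge. *)
pose y := if x == u then v else if x == v then u else p x.
apply: leq_trans (degT x); apply/proper_card/properP; split.
  by apply/subsetP => z; rewrite !inE => /andP[/pP[/sub_eT + _] /eqP<-].
exists y; rewrite /y !inE.
  have [->|xu] := eqVneq x u; first by [].
  have [->|xv] := eqVneq x v; first by rewrite adj_sym.
  have [|/sub_eT] := pP x; first by rewrite (negPf xu) (negPf xv).
  by rewrite adj_sym.
have [->|xu] := eqVneq x u; first by rewrite eqxx orbT.
have [->|xv] := eqVneq x v; first by rewrite eqxx.
have [|_ hx] := pP x; first by rewrite (negPf xu) (negPf xv).
apply/negP => /andP[/pP[_ hpx] /eqP ppx].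
by move: hpx; rewrite ppx ltnNge ltnW.
Qed.


Section Sides.
Variables (s : V -> bool) (p : V -> V) (h : V -> nat).
Let R := [set u; v].
Let root b := if b then u else v.
Let kids x := [set y in ~: R | p y == x].
(** The blocked vertices: the parent and [k.-1] children exhaust the allowed degree, and no child
    can be moved to the root. *)
Let B := [set w in ~: R | (#|kids w| == k.-1) &&
                          [forall y in kids w, ~~ adj G y (root (s w))]].

Hypotheses (k_ge2 : 2 <= k) (su : s u) (sv : ~~ s v).
Hypothesis parentP : forall x, x \notin R ->
  [/\ adj G x (p x), h (p x) < h x & s (p x) = s x].
Hypothesis few_kids : forall x, #|kids x| < k.

Let s_root b : s (root b) = b.
Proof. by case: b => //=; apply: negPf. Qed.

Let rootR b : root b \in R.
Proof. by case: b; rewrite !inE eqxx ?orbT. Qed.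

Let rootE x : x \in R -> x = root (s x).
Proof. by rewrite !inE => /orP[] /eqP->; rewrite ?su ?(negPf sv). Qed.

(** [q] is a modified parent map on the tree of [x]; as it leads to the root or decreases [h], the
    edges from [y] to [q y] connect that side. The term [y == x] reserves one unit of degree at [x]
    for an edge towards the other side. *)
Lemma side_graph_of_parent (q : V -> V) x :
    (forall y, y \notin R -> s y = s x ->
      [/\ adj G y (q y), s (q y) = s x & q y = root (s x) \/ h (q y) < h y]) ->
    (forall y, s y = s x ->
      (y \notin R) + #|[set z in ~: R | q z == y]| + (y == x) <= k) ->
  exists e : rel V,
  [/\ symmetric e, subrel e (adj G),
      forall y z, e y z -> s y = s x /\ s z = s x,
      forall y, s y = s x -> connect e y x
    & forall y, #|[set z | e y z]| + (y == x) <= k].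
Proof.
move=> qP deg_q.
pose e y z := [&& s y == s x, s z == s x
  & (y \notin R) && (q y == z) || (z \notin R) && (q z == y)].
have sym_e : symmetric e by move=> y z; rewrite /e orbC andbCA.
exists e; split=> //.
- move=> y z /and3P[/eqP sy /eqP sz /orP[] /andP[nR /eqP<-]].
    by have [] := qP y nR sy.
  by rewrite adj_sym; have [] := qP z nR sz.
- by move=> y z /and3P[/eqP-> /eqP->].
- have to_root y : s y = s x -> connect e y (root (s x)).
    have [n] := ubnP (h y); elim: n y => // n IHn y; rewrite ltnS => hy sy.
    have [/rootE->|yR] := boolP (y \in R); first by rewrite sy.
    have [_ sq q_lt] := qP y yR sy.
    have eyq : e y (q y) by rewrite /e sy sq !eqxx yR.
    apply: connect_trans (connect1 eyq) _; case: q_lt => [-> //|hq].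
    exact: IHn (leq_trans hq hy) sq.
  move=> y /to_root /connect_trans; apply.
  by rewrite (sym_connect_sym sym_e) to_root.
move=> y; have [sy|syx] := eqVneq (s y) (s x); last first.
  rewrite (_ : [set z | e y z] = set0) ?cards0.
    by have [yx|] := eqVneq y x; [rewrite yx eqxx in syx | ].
  by apply/setP => z; rewrite !inE /e (negPf syx).
apply: leq_trans (deg_q y sy); rewrite leq_add2r.
pose Q := if y \notin R then [set q y] else set0.
have <- : #|Q| = (y \notin R) by rewrite /Q; case: ifP; rewrite ?cards1 ?cards0.
apply: leq_trans (leq_card_setU _ _); apply/subset_leq_card/subsetP => z.
rewrite /Q in_set => /and3P[_ _ /orP[/andP[-> /eqP<-]|/andP[zR /eqP qz]]].
  by rewrite in_setU set11.
by rewrite !inE qz eqxx andbT; move: zR; rewrite !inE => ->; rewrite orbT.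
Qed.

(* If x already has k neighbours in its tree, one of its children is
   adjacent to the root of that tree and can be attached there instead. *)
Lemma side_graph x : x \notin B -> exists e : rel V,
  [/\ symmetric e, subrel e (adj G),
      forall y z, e y z -> s y = s x /\ s z = s x,
      forall y, s y = s x -> connect e y x
    & forall y, #|[set z | e y z]| + (y == x) <= k].
Proof.
move=> xB; have [x_low|] := boolP ((x \in R) || (#|kids x| < k.-1)).
  apply: (@side_graph_of_parent p) => y.
    by move=> yR <-; have [? ? ?] := parentP yR; split=> //; right.
  move=> _; have := few_kids y; rewrite -/(kids y).
  have [->|yx] := eqVneq y x; last by case: (y \notin R); lia.
  by case/orP: x_low => [->|]; [|case: (x \notin R)]; lia.
rewrite negb_or -leqNgt => /andP[xR kids_x].
have {}kids_x : #|kids x| = k.-1.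
  by apply/eqP; rewrite eqn_leq kids_x andbT; have := few_kids x; lia.
move: xB; rewrite in_set in_setC xR kids_x eqxx /= negb_forall.
case/existsP=> y0; rewrite negb_imply negbK => /andP[y0x y0r].
have [y0R py0] : y0 \notin R /\ p y0 = x.
  by move: y0x; rewrite in_set in_setC => /andP[? /eqP].
have sy0 : s y0 = s x by have [_ _ <-] := parentP y0R; rewrite py0.
apply: (@side_graph_of_parent (fun y => if y == y0 then root (s x) else p y)).
  move=> y yR sy; have [->|_] := eqVneq y y0; first by split=> //; left.
  by have [? ? sp] := parentP yR; rewrite sp; split=> //; right.
move=> y sy; set K := [set z in _ | _].
(* The root may gain the child [y0], but it has no parent, so fewer than [k] old children still
   suffices. *)
have [yr|yr] := eqVneq y (root (s x)).
  have yx : (y == x) = false.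
    by apply: contraNF xR => /eqP<-; rewrite yr.
  rewrite yx yr rootR addn0 /=.
  have := few_kids (root (s x)); apply: leq_trans.
  have <- : #|y0 |: kids (root (s x))| = #|kids (root (s x))|.+1.
    rewrite cardsU1 in_set py0 negb_and.
    by rewrite -yr eq_sym yx orbT.
  apply/subset_leq_card/subsetP => z; rewrite /K in_setU1 !in_set yr.
  by case: (z =P y0).
have subK : K \subset kids y.
  apply/subsetP => z; rewrite /K !in_set; case: (z =P y0) => // _.
  by rewrite eq_sym (negPf yr) andbF.
have [yx|yx] := eqVneq y x; last first.
  have := leq_ltn_trans (subset_leq_card subK) (few_kids y).
  move: #|K| #|kids y| => i j; clear -k_ge2.
  by case: (y \notin R); lia.
have : K \proper kids x.
  apply/properP; rewrite -{1}yx; split=> //; exists y0 => //.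
  by rewrite /K in_set eqxx eq_sym (negPf yr) andbF.
move=> /proper_card; rewrite kids_x; move: #|K| => i; clear -k_ge2.
by case: (y \notin R); lia.
Qed.

(** The side graphs of [x] and [w] each reserve one unit of degree at these vertices, which the edge
    xw consumes when it joins them. Hence, in a graph without spanning k-tree, every edge between
    the two sides meets [B]. *)
Lemma cross_edge x w : adj G x w -> s x != s w -> x \notin B -> w \notin B ->
  has_spanning_ktree k G.
Proof.
move=> xw s_xw /side_graph[e1 [sym1 sub1 side1 conn1 deg1]].
move=> /side_graph[e2 [sym2 sub2 side2 conn2 deg2]].
pose f := [rel a b | [|| e1 a b, e2 a b
  | (a == x) && (b == w) || (a == w) && (b == x)]].
have sym_f : symmetric f.
  move=> a b; rewrite /f /= sym1 sym2; congr [|| _, _ | _].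
  by rewrite orbC (andbC (a == x)) (andbC (a == w)).
have sub1f : subrel (connect e1) (connect f).
  by apply: connect_sub => a b ab; apply: connect1; rewrite /f /= ab.
have sub2f : subrel (connect e2) (connect f).
  by apply: connect_sub => a b ab; apply: connect1; rewrite /f /= ab orbT.
have s_or a : s a = s x \/ s a = s w.
  by move: s_xw; case: (s a) (s x) (s w) => [] [] []; auto.
have to_x a : connect f a x.
  have [/conn1/sub1f //|/conn2/sub2f/connect_trans] := s_or a; apply.
  by apply: connect1; rewrite /f /= !eqxx !orbT.
apply: (@spanning_ktree_of_connected _ k G f x) => //.
- move=> a b /or3P[/sub1|/sub2|/orP[]/andP[/eqP-> /eqP->]] //.
  by rewrite adj_sym.
- move=> a b; apply: connect_trans (to_x a) _.
  by rewrite (sym_connect_sym sym_f).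
have low (e : rel V) (y z a : V) : s a = s y -> s y != s z ->
    (forall b, f a b -> e a b \/ a = y /\ b = z) ->
    #|[set b | e a b]| + (a == y) <= k -> #|[set b | f a b]| <= k.
  move=> say syz fE; apply: leq_trans.
  pose Q := if a == y then [set z] else set0.
  have <- : #|Q| = (a == y) by rewrite /Q; case: ifP; rewrite ?cards1 ?cards0.
  apply: leq_trans (leq_card_setU _ _); apply/subset_leq_card/subsetP => b.
  rewrite /Q in_set => /fE[eab|[-> ->]]; first by rewrite !in_set eab.
  by rewrite eqxx !inE eqxx orbT.
move=> a; have [sa|sa] := s_or a.
  apply: (low e1 x w a) => // b /or3P[|/side2[]|/orP[]/andP[/eqP aE /eqP bE]].
  - by left.
  - by move=> saw; rewrite -sa saw eqxx in s_xw.
  - by right.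
  - by rewrite -sa aE eqxx in s_xw.
apply: (low e2 w x a) => // [|b]; first by rewrite eq_sym.
case/or3P=> [/side1[]||/orP[]/andP[/eqP aE /eqP bE]].
- by move=> sax; rewrite -sa sax eqxx in s_xw.
- by left.
- by rewrite -sa aE eqxx in s_xw.
- by right.
Qed.

End Sides.


(** [B] separates [u] from [v], so it has at least [t] elements, and it contains every vertex
    adjacent to the root of the other tree. The (k - 1)|B| children of blocked vertices are not
    adjacent to their own root; counting them against the degrees of [u] and [v] gives the bound.
    The increase of [h] in the first clause serves a later choice of a deepest vertex. *)
Theorem exchange_structure t : 2 <= k -> t_connected t G ->
    u != v -> ~~ adj G u v ->
    ~ has_spanning_ktree k G -> has_spanning_ktree k (add_edge G u v) ->
  exists (s : V -> bool) (h : V -> nat),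
  let own x := if s x then u else v in
  let other x := if s x then v else u in
  [/\ forall w, adj G w (other w) -> exists c,
        [/\ c \notin [set u; v], adj G w c, s c = s w, h w < h c
           & ~~ adj G c (own c)],
      deg G u + deg G v + (k - 2) * t + 2 <= #|V|
    & deg G u + deg G v + (k - 2) * t + 2 = #|V| ->
      t <= #|[set x | adj G x (other x)]|].
Proof.
move=> k_ge2 [_ conG] uv nuv noG GuvT.
have [s [p [h [su sv parentP few_kids]]]] := rooted_forest uv noG GuvT.
exists s, h => own other.
pose R := [set u; v]; pose kids x := [set y in ~: R | p y == x].
pose root (b : bool) := if b then u else v.
pose B := [set w in ~: R | (#|kids w| == k.-1) &&
                          [forall y in kids w, ~~ adj G y (root (s w))]].
have cross x w : adj G x w -> s x != s w -> (x \in B) || (w \in B).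
  move=> xw sxw; apply/negPn/negP; rewrite negb_or => /andP[xB wB].
  exact: noG (cross_edge k_ge2 su sv parentP few_kids xw sxw xB wB).
have uB : u \notin B by rewrite !inE eqxx.
have vB : v \notin B by rewrite !inE eqxx orbT.
have kidP w c : w \in B -> c \notin R -> p c = w ->
    [/\ adj G w c, s c = s w, h w < h c & ~~ adj G c (own c)].
  move=> wB cR pc; have [pcc hc sc] := parentP c cR.
  rewrite -pc in wB *; split=> //; first by rewrite adj_sym.
  move: wB; rewrite in_set => /and3P[_ _ /forall_inP/(_ c)].
  by rewrite in_set in_setC cR eqxx /own -sc; apply.
have sub_crossB : [set x | adj G x (other x)] \subset B.
  have s_other x : s (other x) = ~~ s x.
    by rewrite /other; case: ifP; rewrite ?su ?(negPf sv).
  have otherB x : other x \notin B by rewrite /other; case: ifP.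
  apply/subsetP => x; rewrite in_set => /cross.
  rewrite s_other (negPf (otherB x)) orbF; apply.
  by case: (s x).
have card_B : t <= #|B|.
  rewrite leqNgt; apply/negP => /conG con.
  have uC : u \in ~: B by rewrite in_setC.
  have vC : v \in ~: B by rewrite in_setC.
  (* Outside [B] no edge changes sides, so the side of [u] is closed although [v] is not in it. *)
  pose A := [pred x : {x | x \in ~: B} | s (val x)].
  have /closed_connect/(_ _ _ (con (Sub u uC) (Sub v vC))) :
      closed (adj (induced G (~: B))) A.
    apply: (intro_closed (sym_connect_sym (@adj_sym _ _))) => x y xy.
    rewrite !inE; apply: contraLR => sy; apply/negP => sx.
    have := cross _ _ xy; rewrite sx (negPf sy) => /(_ isT).
    by have := valP x; have := valP y; rewrite !in_setC => /negPf-> /negPf->.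
  by rewrite !inE !SubK su (negPf sv).
have degE : deg G u + deg G v =
    #|[set x | adj G x (other x)]| + #|[set x | adj G x (own x)]|.
  pose S := [set x | s x].
  have split_deg a : deg G a = #|[set x | adj G x a] :&: S| +
      #|[set x | adj G x a] :\: S|.
    rewrite cardsID; apply: eq_card => x.
    by rewrite !inE adj_sym.
  rewrite (split_deg u) (split_deg v).
  rewrite -(cardsID S [set x | adj G x (other x)]).
  rewrite -(cardsID S [set x | adj G x (own x)]).
  have -> : [set x | adj G x (other x)] :&: S = [set x | adj G x v] :&: S.
    by apply/setP => x; rewrite !inE /other; case: (s x); rewrite ?andbF.
  have -> : [set x | adj G x (own x)] :&: S = [set x | adj G x u] :&: S.
    by apply/setP => x; rewrite !inE /own; case: (s x); rewrite ?andbF.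
  have -> : [set x | adj G x (other x)] :\: S = [set x | adj G x u] :\: S.
    by apply/setP => x; rewrite !inE /other; case: (s x).
  have -> : [set x | adj G x (own x)] :\: S = [set x | adj G x v] :\: S.
    by apply/setP => x; rewrite !inE /own; case: (s x).
  lia.
(* The children of blocked vertices, disjoint from the neighbours of their own root and from the two
   roots. *)
pose K := [set y in ~: R | p y \in B].
have card_K : #|K| = k.-1 * #|B|.
  rewrite -sum1_card (partition_big p (mem B)) => [|y]; last first.
    by rewrite in_set => /andP[].
  rewrite mulnC -sum_nat_const; apply: eq_bigr => w wB.
  transitivity #|kids w|.
    rewrite -sum1_card; apply: eq_bigl => y.
    rewrite [y \in K]in_set [y \in kids w]in_set -andbA; congr (_ && _).
    by case: (p y =P w) => [->|]; rewrite ?andbF // andbT; apply: wB.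
  by move: wB; rewrite inE in_set => /and3P[_ /eqP].
have card_own : #|[set x | adj G x (own x)]| + k.-1 * #|B| + 2 <= #|V|.
  have card_R : #|R| = 2 by rewrite cards2 uv.
  pose O := [set x | adj G x (own x)].
  have disjOK : [disjoint O & K].
    rewrite disjoint_sym; apply/pred0P => x /=; rewrite [x \in O]in_set.
    apply/negP => /andP[]; rewrite in_set in_setC => /andP[xR pB].
    by have [_ _ _ /negPf->] := kidP _ _ pB xR erefl.
  have disjR : [disjoint O :|: K & R].
    rewrite disjoint_sym; apply/pred0P => x /=; rewrite in_setU !in_set.
    apply/negP => /andP[xR]; rewrite xR /= orbF /own; move: xR.
    by rewrite !inE => /orP[] /eqP->; rewrite ?su ?(negPf sv) adj_irr.
  rewrite -card_K -card_R -/O.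
  have /eqP <- : #|O :|: K| == #|O| + #|K| by rewrite (leq_card_setU O K).2.
  have /eqP <- : #|(O :|: K) :|: R| == #|O :|: K| + #|R|.
    by rewrite (leq_card_setU _ R).2.
  exact: max_card.
have descent w : adj G w (other w) -> exists c,
    [/\ c \notin R, adj G w c, s c = s w, h w < h c & ~~ adj G c (own c)].
  move=> w_other; have wB : w \in B.
    by apply: (subsetP sub_crossB); rewrite in_set.
  have /card_gt0P[c] : 0 < #|kids w|.
    by move: wB; rewrite in_set => /and3P[_ /eqP-> _]; lia.
  rewrite in_set in_setC => /andP[cR /eqP pc]; exists c.
  by have [] := kidP w c wB cR pc.
split; first exact: descent.
(* With c cross neighbours and o own ones, o + (k - 1)|B| + 2 <= |V| and c <= |B|. In the tight case
   c >= (k - 1)|B| - (k - 2)t >= |B| >= t. *)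
all: have := subset_leq_card sub_crossB; move: card_own; rewrite degE.
all: move: #|_| #|B| card_B #|_| => c b tb o; case: k k_ge2 => [|[|k']] // _.
all: rewrite subSS subSS subn0 /= => card_own cb.
all: have : k' * t <= k' * b by rewrite leq_mul2l tb orbT.
all: lia.
Qed.

End Exchange.

(** * Consequences of the exchange argument *)

Section Obstructions.
Variables (V : finType) (k t : nat) (G : sgraph V) (u v : V).
Hypotheses (k_ge2 : 2 <= k) (conG : t_connected t G).
Hypotheses (uv : u != v) (nuv : ~~ adj G u v).
Hypotheses (noG : ~ has_spanning_ktree k G).
Hypothesis GuvT : has_spanning_ktree k (add_edge G u v).

(** A common neighbour is in particular adjacent to the root of the other tree, so it has a child
    that misses its own root. *)
Lemma common_neighbor_escape w : adj G w u -> adj G w v -> exists c,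
  [/\ c \notin [set u; v], adj G w c & ~~ (adj G c u && adj G c v)].
Proof.
have [s [h [descent _ _]]] := exchange_structure k_ge2 conG uv nuv noG GuvT.
move=> wu wv; have [|c [cR wc _ _ nc]] := descent w; first by case: ifP.
by exists c; split=> //; move: nc; case: ifP => _ /negPf->; rewrite ?andbF.
Qed.

(** In the tight case at least [t] vertices are adjacent to the root of the other tree; all lie in
    [Z]. Otherwise take a deepest one outside [Z]: its child [c] misses its own root, hence is
    outside [Z], and transitivity of adjacency there makes [c] a deeper example. *)
Lemma universal_card_ge (Z : {set V}) :
    deg G u + deg G v + (k - 2) * t + 2 = #|V| ->
    (forall z, z \in Z -> adj G z u && adj G z v) ->
    (forall x y z, x \notin Z -> y \notin Z -> z \notin Z -> x != z ->
       adj G x y -> adj G y z -> adj G x z) ->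
    u \notin Z -> v \notin Z ->
  t <= #|Z|.
Proof.
move=> tight univZ cliques uZ vZ.
have [s [h [descent _ /(_ tight)]]] :=
  exchange_structure k_ge2 conG uv nuv noG GuvT.
move/leq_trans; apply; apply/subset_leq_card/subsetP => x; rewrite in_set.
pose other x := if s x then v else u; rewrite -/(other x).
have otherZ y : other y \notin Z by rewrite /other; case: ifP.
apply: contraTT => xZ; apply/negP => x_other.
pose P := [pred y | (y \notin Z) && adj G y (other y)].
have Px : P x by rewrite /= xZ.
have [y /andP[yZ y_other] max_y] := @arg_maxnP V x P h Px.
have [c [cR yc sc hyc nc]] := descent y y_other.
have cZ : c \notin Z.
  by apply: contra nc => /univZ/andP[cu cv]; case: ifP.
have /max_y : P c; last by rewrite /= leqNgt hyc.
rewrite /= cZ /=; apply: (cliques c y) => //.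
- by move: cR; rewrite !inE negb_or /other => /andP[cu cv]; case: ifP.
- by rewrite adj_sym.
- by rewrite /other sc.
Qed.

End Obstructions.

(** * Connectivity, degrees and edge-maximal supergraphs *)

Section Connectivity.
Variable V : finType.

Lemma t_connected_sub t (G H : sgraph V) :
  subrel (adj G) (adj H) -> t_connected t G -> t_connected t H.
Proof.
move=> subGH [tV conG]; split=> // S /conG con x y.
by apply: connect_sub (con x y) => a b /subGH ab; apply: connect1.
Qed.

Lemma t_connected_connected t (G : sgraph V) :
  0 < t -> t_connected t G -> connected G.
Proof.
move=> t_gt0 [_ /(_ set0)]; rewrite cards0 => /(_ t_gt0) con x y.
have inC (z : V) : z \in ~: set0 by rewrite setC0 inE.
have /connectP[q] := con (Sub x (inC x)) (Sub y (inC y)).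
elim: q x => [|z q IHq] x /=; first by move=> _ /(congr1 val) /= ->.
case/andP=> xz qz def_y.
apply: connect_trans (connect1 (xz : adj G x (val z))) _.
by apply: IHq; [apply: etrans qz | rewrite def_y]; congr (_ _ _);
  apply: val_inj.
Qed.

(** Deleting fewer than [t] neighbours would isolate [x] from some remaining vertex, since there are
    more than [t] vertices. *)
Lemma t_connected_deg t (G : sgraph V) x : t_connected t G -> t <= deg G x.
Proof.
case=> tV conG; rewrite leqNgt; apply/negP => deg_x.
have [y yx nxy] : exists2 y, y != x & ~~ adj G x y.
  have : ~~ ([set: V] \subset x |: [set y | adj G x y]).
    apply/negP => /subset_leq_card; rewrite cardsT cardsU1 inE adj_irr.
    by rewrite leqNgt (leq_ltn_trans _ tV) //.
  by case/subsetPn=> y _; rewrite !inE negb_or => /andP[]; exists y.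
have xC : x \in ~: [set y | adj G x y] by rewrite !inE adj_irr.
have yC : y \in ~: [set y | adj G x y] by rewrite !inE.
have /connectP[[|z q]] := conG _ deg_x (Sub x xC) (Sub y yC).
  by move=> _ /(congr1 val) /= /eqP; rewrite (negPf yx).
by case/andP=> xz _; have := valP z; rewrite !inE [adj _ _ _]xz.
Qed.

Lemma deg_compl (G : sgraph V) x : deg (compl G) x + deg G x + 1 = #|V|.
Proof.
have -> : deg (compl G) x = #|~: [set y | adj G x y] :\ x|.
  by apply: eq_card => y; rewrite !inE /= eq_sym.
have := cardsD1 x (~: [set y | adj G x y]); rewrite !inE adj_irr /=.
have := cardsC [set y | adj G x y]; rewrite /deg => <- ->.
by rewrite [1 + _]addnC addnA (addnC #|[set y | adj G x y]|).
Qed.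

(** The enumeration of [V] is a Hamiltonian path, of maximum degree at most 2. *)
Lemma complete_spanning_ktree k (G : sgraph V) (x0 : V) : 2 <= k ->
  (forall x y, x != y -> adj G x y) -> has_spanning_ktree k G.
Proof.
move=> k_ge2 complete; pose r := @enum_rank V.
pose e x y := ((r x).+1 == r y) || ((r y).+1 == r x).
have sym_e : symmetric e by move=> x y; rewrite /e orbC.
have V_gt0 : 0 < #|V| by apply/card_gt0P; exists x0.
pose a := enum_val (Ordinal V_gt0).
have conn_a x : connect e a x.
  have [n] := ubnP (r x); elim: n x => // n IHn x; rewrite ltnS.
  case def_r: (nat_of_ord (r x)) => [|m] hr.
    rewrite (_ : x = a) //; apply: enum_rank_inj; apply: val_inj.
    by rewrite /= -/(r x) def_r enum_valK.
  have mV : m < #|V| by rewrite ltnW // -def_r.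
  pose y := enum_val (Ordinal mV).
  have ry : nat_of_ord (r y) = m by rewrite /r enum_valK.
  apply: connect_trans (IHn y _) _; first by rewrite ry.
  by apply: connect1; rewrite /e ry def_r eqxx.
apply: (@spanning_ktree_of_connected _ k G e a) => //.
- move=> x y /orP[] /eqP E; apply: complete; apply: contra_eq_neq E => ->.
    by rewrite neq_ltn ltnSn orbT.
  by rewrite neq_ltn ltnSn orbT.
- move=> x y; apply: connect_trans (conn_a y).
  by rewrite (sym_connect_sym sym_e).
- move=> x; apply: leq_trans k_ge2.
  have -> : [set y | e x y] =
      [set y | (r x).+1 == r y] :|: [set y | (r y).+1 == r x].
    by apply/setP => y; rewrite !inE.
  apply: leq_trans (leq_card_setU _ _) _; rewrite -[2]/(1 + 1); apply: leq_add.
    apply/card_le1_eqP => y z; rewrite !inE => /eqP Ey /eqP Ez.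
    by apply: enum_rank_inj; apply: val_inj; rewrite /= -/(r y) -/(r z) -Ey -Ez.
  apply/card_le1_eqP => y z; rewrite !inE => /eqP Ey /eqP Ez.
  apply: enum_rank_inj; apply: val_inj; apply: succn_inj.
  by rewrite /= -/(r y) -/(r z) Ey Ez.
Qed.

Lemma edge_maximal k (G : sgraph V) : ~ has_spanning_ktree k G ->
  exists H : sgraph V, [/\ subrel (adj G) (adj H), ~ has_spanning_ktree k H
    & forall u v, u != v -> ~~ adj H u v ->
        has_spanning_ktree k (add_edge H u v)].
Proof.
have [n] := ubnP #|[set xy : V * V | ~~ adj G xy.1 xy.2]|.
elim: n G => // n IHn G; rewrite ltnS => hn noG.
have [maxG|] := pselect (forall u v, u != v -> ~~ adj G u v ->
    has_spanning_ktree k (add_edge G u v)).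
  by exists G; split.
case/existsNP=> u /existsNP[v] /not_implyP[uv] /not_implyP[nuv noGuv].
have subG : subrel (adj G) (adj (add_edge G u v)).
  by move=> x y Gxy; rewrite /= /insert_edge /= Gxy.
have [|H [subH noH maxH]] := IHn (add_edge G u v) _ noGuv.
  apply: leq_trans hn; apply/proper_card/properP; split.
    by apply/subsetP => xy; rewrite !inE; apply/contra/subG.
  by exists (u, v); rewrite !inE /= ?/insert_edge /= ?uv ?eqxx ?orbT // nuv.
by exists H; split=> // x y /subG/subH.
Qed.

End Connectivity.

(** * The extremal graphs *)

(* Rayleigh's inequality for the vector of the square roots of the degrees. *)
Lemma edge_degree_product (R : realType) (V : finType) (K L : sgraph V)
    (m : nat) :
    subrel (adj K) (adj L) ->
    (forall x y, adj K x y -> m <= deg K x * deg K y) ->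
    (rho R L <= Num.sqrt m%:R)%R ->
  forall x y, adj K x y -> deg K x * deg K y = m.
Proof.
move=> subKL degK rhoL x y Kxy; apply/eqP; rewrite eqn_leq degK // andbT.
pose D z : R := (deg K z)%:R%R; pose w z : R := Num.sqrt (D z).
have D_ge0 z : (0 <= D z)%R by rewrite ler0n.
(* The squares of [w] sum to the number of ordered adjacent pairs, so Rayleigh's inequality says
   that the terms [F a b] have sum at most 0. Being nonnegative, they all vanish. *)
pose F a b : R := ((adj K a b)%:R * (w a * w b - Num.sqrt m%:R))%R.
have F_ge0 a b : (0 <= F a b)%R.
  rewrite /F; case Kab: (adj K a b); last by rewrite mul0r.
  by rewrite mul1r subr_ge0 -sqrtrM // ler_wsqrtr // -natrM ler_nat degK.
have sumD : (\sum_z w z ^+ 2 = \sum_a \sum_b (adj K a b)%:R :> R)%R.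
  apply: eq_bigr => a _; rewrite sqr_sqrtr // /D /deg -sum1_card natr_sum.
  by rewrite big_mkcond; apply: eq_bigr => b _; rewrite inE; case: (adj K a b).
have sumF : (\sum_a \sum_b F a b <= 0)%R.
  have -> : (\sum_a \sum_b F a b =
      \sum_a \sum_b (adj K a b)%:R * (w a * w b) -
      Num.sqrt m%:R * \sum_z w z ^+ 2)%R.
    rewrite sumD mulr_sumr -sumrB; apply: eq_bigr => a _.
    rewrite mulr_sumr -sumrB; apply: eq_bigr => b _.
    by rewrite /F mulrBr (mulrC _ (Num.sqrt m%:R)%R).
  rewrite subr_le0; apply: le_trans (ler_wpM2r _ rhoL); last first.
    by apply: sumr_ge0 => z _; rewrite sqr_ge0.
  apply: le_trans (rayleigh_le_rho L w).
  apply: ler_sum => a _; apply: ler_sum => b _.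
  apply: ler_wpM2r; first by rewrite mulr_ge0 ?sqrtr_ge0.
  by rewrite ler_nat; case: (boolP (adj K a b)) => // /subKL->.
have : (F x y <= 0)%R.
  apply: le_trans sumF; rewrite (bigD1 x) //= (bigD1 y) //= -addrA lerDl.
  by apply: addr_ge0; repeat (apply: sumr_ge0 => ? _).
rewrite /F Kxy mul1r subr_le0 -sqrtrM // ler_sqrt ?ler0n //.
by rewrite -natrM ler_nat.
Qed.

Lemma join_decomposition (V : finType) (G : sgraph V) (Z : {set V}) a b :
    #|Z| = a -> #|~: Z| = b ->
    (forall x y, x \in Z -> y \notin Z -> adj G x y) ->
  exists (G1 : sgraph 'I_a) (G2 : sgraph 'I_b), isomorphic G (join G1 G2) /\
    forall i, exists2 x, x \notin Z & deg G2 i = #|[set y | adj G x y] :\: Z|.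
Proof.
move=> <- <- univZ.
pose sub (A : {set V}) : rel 'I_#|A| :=
  fun i j => adj G (enum_val i) (enum_val j).
have sub_sym A : symmetric (sub A) by move=> i j; apply: adj_sym.
have sub_irr A : irreflexive (sub A) by move=> i; apply: adj_irr.
exists (SGraph (sub_sym Z) (sub_irr Z)).
exists (SGraph (sub_sym (~: Z)) (sub_irr (~: Z))).
have valC (j : 'I_#|~: Z|) : enum_val j \notin Z.
  by have := enum_valP j; rewrite in_setC.
split; last first.
  move=> j; exists (enum_val j) => //.
  rewrite /deg -(card_imset _ (@enum_val_inj _ (mem (~: Z)))).
  apply: eq_card => y; rewrite in_setD in_set; apply/imsetP/andP.
    by case=> l; rewrite inE => jl ->.
  move=> [yZ jy]; have yC : y \in ~: Z by rewrite in_setC.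
  exists (enum_rank_in yC y); last by rewrite enum_rankK_in.
  by rewrite inE /= /sub enum_rankK_in.
pose g (p : 'I_#|Z| + 'I_#|~: Z|) : V :=
  match p with inl i => enum_val i | inr j => enum_val j end.
have g_inj : injective g.
  move=> [i|i] [j|j] /=.
  - by move/enum_val_inj->.
  - by move=> E; have := valC j; rewrite -E enum_valP.
  - by move=> E; have := valC i; rewrite E enum_valP.
  - by move/enum_val_inj->.
have [f gK fK] : bijective g.
  by apply: inj_card_bij => //; rewrite card_sum !card_ord cardsC.
exists f => [|x y]; first by exists g.
rewrite -{2}(fK x) -{2}(fK y).
case: (f x) (f y) => [i|i] [j|j] //=.
  by rewrite univZ // enum_valP.
by rewrite adj_sym univZ // enum_valP.
Qed.

(** With i = a - p, j = a - q and e = p + q - a - b, the excess pq - ab equals i(e + j) + pe, a sum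
    of nonnegative terms; here p > 0, so equality forces e = 0 and i = 0 or j = 0. *)
Lemma eq_extreme_product p q a b :
    0 < b -> p <= a -> q <= a -> a + b <= p + q ->
  a * b <= p * q /\ (p * q = a * b -> p = a /\ q = b \/ p = b /\ q = a).
Proof.
move=> b_gt0 pa qa pq.
have [i def_a] : exists i, a = p + i by exists (a - p); lia.
have [e def_q] : exists e, q = b + i + e by exists (q - b - i); lia.
have [j def_j] : exists j, p = b + e + j by exists (p - b - e); lia.
subst q a.
have E : p * (b + i + e) = (p + i) * b + i * (e + j) + p * e.
  by rewrite !mulnDl !mulnDr {2 4}def_j; lia.
rewrite E; split; first by lia.
move=> E0; have {}E0 : i * (e + j) + p * e = 0 by lia.
move/eqP: E0; rewrite addn_eq0 !muln_eq0.
by case/andP=> /orP[] /eqP ? /orP[] /eqP ?; lia.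
Qed.

Section Extremal.
Variables (V : finType) (k t : nat) (G H : sgraph V).
Hypotheses (t_gt0 : 0 < t) (k_ge2 : 2 <= k).
Hypotheses (conG : t_connected t G) (subGH : subrel (adj G) (adj H)).
Hypothesis noH : ~ has_spanning_ktree k H.
Hypothesis maxH : forall u v, u != v -> ~~ adj H u v ->
  has_spanning_ktree k (add_edge H u v).

Local Notation K := (compl H).
Local Notation a := (#|V| - 1 - t).
Local Notation b := (k * t - t + 1).

Hypothesis degK : forall x y, adj K x y ->
  deg K x = a /\ deg K y = b \/ deg K x = b /\ deg K y = a.

Let conH : t_connected t H := t_connected_sub subGH conG.

Let tV : t < #|V|. Proof. by case: conG. Qed.

Let kt : k * t = (k - 2) * t + t + t.
Proof. by rewrite -[in LHS](subnK k_ge2) mulnDl; lia. Qed.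

Let degKH x : deg K x + deg H x + 1 = #|V| := deg_compl H x.

(** Complement degrees sum to a + b = |V| + (k - 2)t on every edge of [K], which is equality in the
    exchange bound. *)
Let tight x y : adj K x y -> deg H x + deg H y + (k - 2) * t + 2 = #|V|.
Proof.
move=> /degK; move: (degKH x) (degKH y) tV kt.
by move: ((k - 2) * t) (k * t) #|V| => ? ? ?; lia.
Qed.

Lemma complement_has_edge : exists x y, adj K x y.
Proof.
have [x0 _] : exists x0, x0 \in V by apply/card_gt0P; apply: leq_ltn_trans tV.
apply: contrapT => noK; apply: noH.
apply: (complete_spanning_ktree x0) => // x y xy.
by apply: contra_notT noK => nxy; exists x, y; apply/andP.
Qed.

(* Otherwise K would be bipartite between the vertices of degree a and those
   of degree b; there are at least b of the former and a of the latter, so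
   that K would be complete bipartite and H disconnected. *)
Lemma complement_regular : a = b.
Proof.
apply/eqP/negPn/negP => ab.
have [x [y]] : exists x y, [/\ adj K x y, deg K x = a & deg K y = b].
  have [x [y Kxy]] := complement_has_edge.
  case: (degK Kxy) => [] []; first by exists x, y.
  by exists y, x; rewrite adj_sym.
case=> Kxy degx degy.
pose P := [set z | deg K z == a]; pose Q := [set z | deg K z == b].
have nbrP z : z \in P -> [set w | adj K z w] \subset Q.
  rewrite inE => /eqP degz; apply/subsetP => w; rewrite !inE => /degK.
  by rewrite degz => -[[_ ->] //|[E]]; rewrite E eqxx in ab.
have nbrQ z : z \in Q -> [set w | adj K z w] \subset P.
  rewrite inE => /eqP degz; apply/subsetP => w; rewrite !inE => /degK.
  by rewrite degz => -[[E]|[_ ->] //]; rewrite E eqxx in ab.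
have xP : x \in P by rewrite inE degx.
have yQ : y \in Q by rewrite inE degy.
have yP : y \notin P by rewrite inE degy eq_sym.
have aQ : a <= #|Q| by rewrite -degx; apply: subset_leq_card (nbrP x xP).
have bP : b <= #|P| by rewrite -degy; apply: subset_leq_card (nbrQ y yQ).
have disjPQ : [disjoint P & Q].
  apply/pred0P => z /=; rewrite !inE; apply/negP => /andP[/eqP-> E].
  by rewrite E in ab.
have cardPQ : #|P :|: Q| = #|P| + #|Q|.
  by apply/eqP; rewrite (leq_card_setU P Q).2.
have leV : #|P| + #|Q| <= #|V| by rewrite -cardPQ max_card.
(* The disjoint sets [P] and [Q] have together at least a + b >= |V| elements. *)
have PQ_all z : z \in P :|: Q.
  have /eqP -> : P :|: Q == setT; last by rewrite inE.
  rewrite eqEcard subsetT cardsT cardPQ /=; move: aQ bP tV kt.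
  by move: ((k - 2) * t) (k * t) #|V| #|P| #|Q| => *; lia.
have closedP : closed (adj H) (mem P).
  apply: (intro_closed (sym_connect_sym (@adj_sym _ H))) => z w zw zP.
  have := PQ_all w; rewrite in_setU => /orP[//|wQ].
  suff: w \in [set w | adj K z w] by rewrite in_set => /andP[_]; rewrite zw.
  (* The a neighbours of [z] in [K] fill [Q], because |Q| <= |V| - b <= a. *)
  suff /eqP -> : [set w | adj K z w] == Q by [].
  rewrite eqEcard nbrP //=.
  move: zP; rewrite inE => /eqP degz; rewrite -/(deg K z) degz.
  move: leV bP tV kt.
  by move: ((k - 2) * t) (k * t) #|V| #|P| #|Q| => *; lia.
have := closed_connect closedP (t_connected_connected t_gt0 conH x y).
by rewrite xP (negPf yP).
Qed.

Let Z := [set z | deg K z == 0].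

Let degW x : x \notin Z -> deg K x = a.
Proof.
rewrite inE -lt0n => /card_gt0P[y]; rewrite inE => /degK.
by rewrite -complement_regular => -[] [].
Qed.

Let Z_univ z y : z \in Z -> y != z -> adj H z y.
Proof.
rewrite inE cards_eq0 => /eqP/setP/(_ y); rewrite !inE /= => + yz.
by rewrite /compl_rel /= eq_sym yz => /negbFE.
Qed.

(** The complement of [H] lies in that of [G]. At [x] the former has degree a and the latter at most
    a, since [G] has minimum degree at least [t]; so the neighbourhoods coincide. *)
Let adjW x y : x \notin Z -> adj G x y = adj H x y.
Proof.
move=> xZ; suff /setP/(_ y) : [set y | adj K x y] = [set y | adj (compl G) x y].
  rewrite !inE /= /compl_rel /=.
  have [->|_] := eqVneq x y; first by rewrite !adj_irr.
  by move=> E; apply: negb_inj.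
apply/eqP; rewrite eqEcard; apply/andP; split.
  apply/subsetP => z; rewrite !in_set => /andP[xz nxz]; apply/andP; split=> //.
  by apply: contra nxz; apply: subGH.
rewrite -/(deg (compl G) x) -/(deg K x) degW //.
by have := deg_compl G x; have := t_connected_deg x conG; lia.
Qed.

Let ZW x y : x \in Z -> y \notin Z -> adj G x y.
Proof.
move=> xZ yZ; rewrite adj_sym adjW // adj_sym Z_univ //.
by apply: contraNneq yZ => ->.
Qed.

Let degGW x : x \notin Z -> deg G x = t.
Proof.
move=> xZ; have -> : deg G x = deg H x.
  by apply: eq_card => y; rewrite !inE adjW.
have [y Kxy] : exists y, adj K x y.
  by move: xZ; rewrite inE -lt0n => /card_gt0P[y]; rewrite inE; exists y.
by have := degKH x; rewrite degW //; have := tV; lia.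
Qed.

Let degW_in x : x \notin Z -> #|[set y | adj G x y] :\: Z| + #|Z| = t.
Proof.
move=> xZ; rewrite -(degGW xZ) /deg -(cardsID Z [set y | adj G x y]) addnC.
congr (_ + _); apply: eq_card => z; rewrite !inE.
by case: (boolP (deg K z == 0)) => zZ; rewrite ?andbF // adj_sym ZW // inE.
Qed.

Let Z_le : #|Z| <= t.
Proof.
have [x [y Kxy]] := complement_has_edge.
have /degW_in : x \notin Z; last by lia.
by rewrite inE -lt0n; apply/card_gt0P; exists y; rewrite inE.
Qed.

(* For t - |Z| at most 2, the graph H - Z either contains an induced path with
   three vertices, the middle one having no further neighbour outside Z, or is
   a disjoint union of cliques. *)
Let few_universal : t <= #|Z| + 2 -> #|Z| = t.
Proof.
move=> tZ; apply/eqP; rewrite eqn_leq Z_le /=.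
have [[x [w [y [xZ wZ yZ]]]]|noP3] := pselect (exists x w y,
    [/\ x \notin Z, w \notin Z, y \notin Z
      & [&& adj K x y, adj H x w & adj H w y]]).
  case/and3P=> /andP[xy nxy] xw wy; rewrite adj_sym in xw.
  have [c [cR wc]] :=
    common_neighbor_escape k_ge2 conH xy nxy noH (maxH xy nxy) xw wy.
  move: cR; rewrite !inE negb_or => /andP[cx cy] ncxy.
  have cZ : c \notin Z.
    by apply: contra ncxy => cZ; rewrite !Z_univ // eq_sym.
  (* [x], [y] and [c] would be three neighbours of [w] outside [Z], where [w] has only t - |Z| <=
     2. *)
  have : 3 <= #|[set y | adj G w y] :\: Z|.
    rewrite (_ : 3 = #|[set x; y; c]|); last first.
      by rewrite -setUA !cardsU1 cards1 !inE !negb_or xy eq_sym cx eq_sym cy.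
    apply/subset_leq_card/subsetP => z; rewrite [z \in _ :\: _]inE.
    rewrite [z \in [set _ | _]]inE adjW // 2!in_setU !in_set1.
    by move=> /orP[/orP[]|] /eqP->; apply/andP.
  move: (degW_in wZ) tZ; move: #|[set y | adj G w y] :\: Z| #|Z| => i j.
  by clear; lia.
have [x [y Kxy]] := complement_has_edge; have /andP[xy nxy] := Kxy.
have inW u v : adj K u v -> u \notin Z.
  by move=> uv; rewrite inE -lt0n; apply/card_gt0P; exists v; rewrite inE.
have xZ := inW _ _ Kxy.
have yZ : y \notin Z by apply: (inW y x); rewrite adj_sym.
apply: (universal_card_ge k_ge2 conH xy nxy noH (maxH xy nxy) (tight Kxy)) => //.
  move=> z zZ; rewrite !Z_univ //.
    by apply: contraNneq yZ => ->.
  by apply: contraNneq xZ => ->.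
move=> u w v uZ wZ vZ uv uw wv; apply: contra_notT noP3 => nuv.
by exists u, w, v; split=> //; apply/and3P; split=> //; apply/andP.
Qed.

Lemma extremal_families : family1 k t G \/ family2 k t G.
Proof.
(* The equality a = b amounts to |V| = kt + 2. *)
have card_W : #|~: Z| = k * t + 2 - #|Z|.
  move: (cardsC Z) complement_regular tV kt.
  by move: ((k - 2) * t) (k * t) #|V| #|Z| #|~: Z| => *; lia.
have [r3|r3] := leqP (#|Z| + 3) t.
  right; have [G1 [G2 [isoG degG2]]] := join_decomposition erefl card_W ZW.
  exists #|Z|, G1, G2; split=> // i; have [x xZ ->] := degG2 i.
  by have := degW_in xZ; lia.
left; have card_Z : #|Z| = t by apply: few_universal; lia.
have {}card_W : #|~: Z| = k * t - t + 2.
  by rewrite card_W card_Z; have := kt; lia.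
have [G1 [G2 [[f f_bij adjf] degG2]]] := join_decomposition card_Z card_W ZW.
exists G1; exists f => // x y; rewrite -adjf.
case: (f x) (f y) => [i|i] [j|j] //=.
(* As |Z| = t, the part outside [Z] is 0-regular, hence edgeless. *)
have [z zZ /esym] := degG2 i; rewrite (_ : #|_| = 0); last first.
  by have := degW_in zZ; lia.
by move=> /esym/eqP; rewrite cards_eq0 => /eqP/setP/(_ j); rewrite !inE => ->.
Qed.

End Extremal.

Lemma no_ktree_families (R : realType) (t k : nat) (V : finType)
    (G : sgraph V) :
    0 < t -> 2 <= k -> t_connected t G ->
    (rho R (compl G) <= Num.sqrt
      ((#|V|%:R - 1 - t%:R) * (k%:R * t%:R - t%:R + 1)))%R ->
  ~ has_spanning_ktree k G -> family1 k t G \/ family2 k t G.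
Proof.
move=> t_gt0 k_ge2 conG rhoG noG.
have [H [subGH noH maxH]] := edge_maximal noG.
apply: (extremal_families t_gt0 k_ge2 conG subGH noH maxH).
have conH := t_connected_sub subGH conG; have [tV _] := conG.
have kt : k * t = (k - 2) * t + t + t.
  by rewrite -[in LHS](subnK k_ge2) mulnDl; lia.
pose a := #|V| - 1 - t; pose b := k * t - t + 1.
(* Both complement degrees are at most a because [H] has minimum degree at least [t], and the
   exchange bound makes their sum at least a + b. *)
have degE x y : adj (compl H) x y ->
    a * b <= deg (compl H) x * deg (compl H) y /\
    (deg (compl H) x * deg (compl H) y = a * b ->
     deg (compl H) x = a /\ deg (compl H) y = b \/
     deg (compl H) x = b /\ deg (compl H) y = a).
  case/andP=> xy nxy.
  have [s [h [_ + _]]] :=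
    exchange_structure k_ge2 conH xy nxy noH (maxH _ _ xy nxy).
  have := deg_compl H x; have := deg_compl H y.
  have := t_connected_deg x conH; have := t_connected_deg y conH.
  move: tV kt; rewrite /a /b.
  by move: ((k - 2) * t) (k * t) #|V| => *; apply: eq_extreme_product; lia.
move=> x y Kxy; apply: (degE x y Kxy).2.
apply: (@edge_degree_product R V (compl H) (compl G)) =>
    // [u v|u v /degE[]//|].
  case/andP=> uv nuv; apply/andP; split=> //.
  by apply: contra nuv; apply: subGH.
(* The truncated subtractions in [a] and [b] are exact, as t < |V| and t <= kt. *)
apply: le_trans rhoG _; rewrite natrM /a /b natrD !natrB ?natrM //.
all: by move: tV kt; move: ((k - 2) * t) (k * t) #|V| => *; lia.
Qed.

Theorem theorem3p10 (R : realType) (t k n : nat) (V : finType) (G : sgraph V)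
    (ht : 1 <= t) (hk : 2 <= k) (hn : (k - 2) * t + 4 <= n)
    (hG : #|V| = n) (hconn : t_connected t G)
    (hrho : (rho R (compl G) <=
      Num.sqrt ((n%:R - 1 - t%:R) * (k%:R * t%:R - t%:R + 1)))%R) :
  (t = 1 \/ t = 2 -> ~ family1 k t G -> has_spanning_ktree k G) /\
  (3 <= t <= n - 1 -> ~ family2 k t G ->
     ~ family1 k t G -> has_spanning_ktree k G).
Proof.
rewrite -hG in hrho; have families := no_ktree_families ht hk hconn hrho.
split=> [t12 no1|_ no2 no1]; apply: contrapT => /families[] //.
(* For t <= 2 the condition r + 3 <= t leaves [family2] empty. *)
by case=> r [Gr [H [rt _ _]]]; lia.
Qed.
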